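(* Let $n\ge2$ and let $x_1,\ldots,x_n,y_1,\ldots,y_n\in\mathbb{Q}$ satisfy $[x_1,\ldots,x_n]=^n_{n-1}[y_1,\ldots,y_n]$. Then the following are equivalent: (i) $\sum_{i=1}^nx_i=0$; (ii) $\sum_{i=1}^nx_i^{n+1}=\sum_{i=1}^ny_i^{n+1}$.
   Context: $[x_1,\ldots,x_n]=^n_{n-1}[y_1,\ldots,y_n]$ means that the multisets $\{x_1,\ldots,x_n\}$ and $\{y_1,\ldots,y_n\}$ have no element in common and $\sum_{i=1}^nx_i^k=\sum_{i=1}^ny_i^k$ for every $k=1,\ldots,n-1$. *)

(* Defs.v *)
From HB Require Import structures.
From mathcomp Require Import all_boot all_order all_algebra.

Set Implicit Arguments.
Unset Strict Implicit.
Unset Printing Implicit Defensive.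

Import GRing.Theory.
Local Open Scope ring_scope.

(* [x_1, ..., x_n] =^n_(n-1) [y_1, ..., y_n].  The indices run over 0 .. n-1,
   and "the multisets have no element in common" is: no x_i equals any y_j
   (repetitions inside one family are allowed). *)
Definition pte_ideal (n : nat) (x y : 'I_n -> rat) : Prop :=
  (forall i j : 'I_n, x i <> y j) /\
  (forall k : nat, (1 <= k <= n - 1)%N ->
     \sum_(i < n) x i ^+ k = \sum_(i < n) y i ^+ k).

(* Main.v *)
Require Import Defs.
From mathcomp Require Import all_boot all_order all_algebra.
From mathcomp Require Import ring zify.
Import GRing.Theory Num.Theory.
Local Open Scope ring_scope.

Set Implicit Arguments.
Unset Strict Implicit.
Unset Printing Implicit Defensive.

(* Write P and Q for the monic polynomials with roots x_i and y_i, and p_k for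
   the k-th power sum of the x_i.  By Newton's identities, equality of the power
   sums up to n - 1 means that P - Q is a constant c, and c <> 0 as there is no
   common root.  Summing P(x_i) = 0 and P(y_i) = c, then x_i P(x_i) = 0 and
   y_i P(y_i) = c y_i, shows that the power sums of x and y differ by - n c in
   degree n and by - (n + 1) c p_1 in degree n + 1. *)

Lemma deriv_prod (R : comNzRingType) (n : nat) (F : 'I_n -> {poly R}) :
  (\prod_(i < n) F i)^`() =
  \sum_(i < n) (F i)^`() * \prod_(j < n | j != i) F j.
Proof.
elim: n F => [|n IHn] F; first by rewrite !big_ord0 derivC.
rewrite !big_ord_recl derivM IHn; congr (_ + _).
  congr (_ * _); rewrite [RHS]big_mkcond big_ord_recl /= mul1r.
  by apply: eq_bigr.
rewrite mulr_sumr; apply: eq_bigr => i _.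
rewrite mulrCA; congr (_ * _); rewrite [RHS]big_mkcond big_ord_recl /=.
congr (_ * _); rewrite big_mkcond; apply: eq_bigr => j _.
by rewrite (inj_eq lift_inj).
Qed.

(** Each coefficient of the product is $q_{j+k} - a q_{j+k+1}$, so weighting by $a^k$ telescopes.
    Once [j + N] exceeds the degree of [q], this recovers the coefficients of a quotient by $X - a$
    from those of the dividend. *)
Lemma coef_mul_XsubC_telescope (R : comNzRingType) (a : R) (q : {poly R})
    (j N : nat) :
  \sum_(k < N) (('X - a%:P) * q)`_(j.+1 + k) * a ^+ k =
  q`_j - a ^+ N * q`_(j + N).
Proof.
elim: N => [|N IHN]; first by rewrite big_ord0 expr0 mul1r addn0 subrr.
rewrite big_ord_recr /= IHN mulrBl coefB coefXM coefCM addSn addnS /= exprS.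
ring.
Qed.

Definition roots_poly (R : comNzRingType) (n : nat) (x : 'I_n -> R) : {poly R} :=
  \prod_(i < n) ('X - (x i)%:P).

Section RootsPoly.
Variables (R : comNzRingType) (n : nat).
Implicit Type x : 'I_n -> R.

Lemma size_roots_poly x : size (roots_poly x) = n.+1.
Proof. by rewrite size_prod_XsubC /index_enum -enumT size_enum_ord. Qed.

Lemma coefn_roots_poly x : (roots_poly x)`_n = 1.
Proof.
by have := lead_coef_prod_XsubC (index_enum 'I_n) xpredT x;
   rewrite lead_coefE -/(roots_poly x) size_roots_poly.
Qed.

Lemma roots_poly_root x i : (roots_poly x).[x i] = 0.
Proof. by rewrite /roots_poly (bigD1 i) //= hornerM hornerXsubC subrr mul0r. Qed.

(** Read off the coefficient of index [j] in $P' = \sum_i P/(X - x_i)$, expanding each quotient by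
    the telescoping sum. Each quotient has degree $n - 1$, so the bound on [j + N] kills the
    remainder term. *)
Lemma newton_identity x (j N : nat) : (n <= j + N)%N ->
  (roots_poly x)`_j.+1 *+ j.+1 =
  \sum_(k < N) (roots_poly x)`_(j.+1 + k) * \sum_(i < n) x i ^+ k.
Proof.
move=> le_n; rewrite -coef_deriv {1}/roots_poly deriv_prod coef_sum.
under [RHS]eq_bigr do rewrite mulr_sumr.
rewrite exchange_big; apply: eq_bigr => i _ /=.
rewrite derivXsubC mul1r.
set q := \prod_(_ < n | _) _.
have Pq : roots_poly x = ('X - (x i)%:P) * q by rewrite /roots_poly (bigD1 i).
have q_neq0 : q != 0 by rewrite monic_neq0 ?monic_prod_XsubC.
have szq : (size q <= n)%N.
  by rewrite -ltnS -(size_roots_poly x) Pq size_monicM ?monicXsubC // size_XsubC.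
rewrite Pq coef_mul_XsubC_telescope (nth_default 0 (leq_trans szq le_n)).
by rewrite mulr0 subr0.
Qed.

End RootsPoly.

Section EqualPowerSums.
Variables (R : numDomainType) (n : nat) (x y : 'I_n -> R).
Hypothesis eq_psum : forall k : nat, (1 <= k <= n - 1)%N ->
  \sum_(i < n) x i ^+ k = \sum_(i < n) y i ^+ k.

(** Descending induction on [m]: Newton's identity determines a coefficient from the higher ones and
    from power sums of exponent at most $n - m$, which is below $n$ as [m] is positive. *)
Lemma coef_roots_poly_eq (m : nat) : (0 < m)%N ->
  (roots_poly x)`_m = (roots_poly y)`_m.
Proof.
have [d] := ubnP (n - m); elim: d m => // d IHd m ltd m_gt0.
have [lt_nm|lt_mn|<-] := ltngtP n m; last by rewrite !coefn_roots_poly.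
  by rewrite !nth_default ?size_roots_poly.
case: m m_gt0 => // j _ in ltd lt_mn *.
have [N nE] : exists N, n = (j + N.+1)%N by exists (n - j).-1; lia.
have psum0 (z : 'I_n -> R) : \sum_(i < n) z i ^+ 0 = n%:R.
  by rewrite sumr_const card_ord.
have le_n : (n <= j + N.+1)%N by rewrite -nE.
have Nx := newton_identity x le_n; have Ny := newton_identity y le_n.
rewrite !big_ord_recl /= !psum0 !addn0 in Nx Ny.
have eq_tail : \sum_(i < N) (roots_poly x)`_(j.+1 + bump 0 i)
      * \sum_(l < n) x l ^+ bump 0 i
    = \sum_(i < N) (roots_poly y)`_(j.+1 + bump 0 i)
      * \sum_(l < n) y l ^+ bump 0 i.
  apply: eq_bigr => i _; have := ltn_ord i; rewrite /bump /= => lt_iN.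
  by rewrite eq_psum ?IHd //; lia.
(* The term [k = 0] contributes $n$ times the unknown coefficient of index [j.+1]; moved to the
   other side, it leaves the factor $n - (j + 1)$, nonzero in characteristic 0. *)
have nj : (n - j.+1)%:R != 0 :> R by rewrite pnatr_eq0; lia.
apply: (mulIf nj); rewrite natrB 1?ltnW // !mulrBr !mulr_natr.
by rewrite Nx Ny eq_tail !mulr_natr !opprD !addrA !subrr.
Qed.

Let c := (roots_poly x)`_0 - (roots_poly y)`_0.

Lemma roots_poly_eqDC : roots_poly x = roots_poly y + c%:P.
Proof.
apply/polyP => -[|m]; rewrite coefD coefC /=; first by rewrite addrC subrK.
by rewrite addr0 coef_roots_poly_eq.
Qed.

(** Both parts are sums of $P(z_i) z_i^r$: for $z = x$ every term vanishes, and for $z = y$ one has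
    $P(y_i) = c$. *)
Lemma psum_moment_diff (r : nat) :
  \sum_(m < n.+1) (roots_poly x)`_m *
    (\sum_(i < n) x i ^+ (m + r) - \sum_(i < n) y i ^+ (m + r)) =
  - (c * \sum_(i < n) y i ^+ r).
Proof.
have moment (z : 'I_n -> R) : \sum_(m < n.+1) (roots_poly x)`_m *
    (\sum_(i < n) z i ^+ (m + r)) = \sum_(i < n) (roots_poly x).[z i] * z i ^+ r.
  under eq_bigr do rewrite mulr_sumr.
  rewrite exchange_big; apply: eq_bigr => i _ /=.
  rewrite (@horner_coef_wide _ n.+1) ?size_roots_poly // mulr_suml.
  by apply: eq_bigr => m _; rewrite exprD mulrA.
under eq_bigr do rewrite mulrBr.
rewrite sumrB !moment big1 ?sub0r => [|i _]; last by rewrite roots_poly_root mul0r.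
rewrite mulr_sumr; congr (- _); apply: eq_bigr => i _.
by rewrite roots_poly_eqDC hornerD hornerC roots_poly_root add0r.
Qed.

Lemma psum_diff_succ : (2 <= n)%N ->
  \sum_(i < n) x i ^+ n.+1 - \sum_(i < n) y i ^+ n.+1 =
  - (n.+1%:R * c * \sum_(i < n) x i).
Proof.
move=> n_ge2.
have psum1 : \sum_(i < n) x i = \sum_(i < n) y i.
  by have := @eq_psum 1%N; rewrite subn_gt0 n_ge2; apply.
(* Newton's identity with two terms reads $(n-1) P_{n-1} = n P_{n-1} + p_1$. *)
have coef_pred : (roots_poly x)`_n.-1 = - \sum_(i < n) x i.
  have [m nE] : exists m, n = m.+2 by exists n.-2; lia.
  have le_n : (n <= m + 2)%N by lia.
  have := newton_identity x le_n.
  have [-> n1E] : n.-1 = m.+1 /\ (m.+1 + bump 0 0)%N = n by rewrite /bump /=; lia.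
  rewrite !big_ord_recl big_ord0 /= n1E addr0 addn0 sumr_const card_ord.
  rewrite coefn_roots_poly mul1r.
  under [\sum_(i < n) x i ^+ bump 0 0]eq_bigr do rewrite expr1.
  have n_nat : n%:R = m.+1%:R + 1 :> R by rewrite nE natr1.
  rewrite n_nat -[LHS]mulr_natr => E; apply/eqP; rewrite -addr_eq0; apply/eqP.
  by apply: (addrI ((roots_poly x)`_m.+1 * m.+1%:R)); rewrite addr0 [RHS]E; ring.
have eq0 k : (k <= n - 1)%N ->
    \sum_(i < n) x i ^+ k - \sum_(i < n) y i ^+ k = 0.
  by case: k => [|k] le_k; [rewrite !sumr_const | rewrite eq_psum ?le_k]; rewrite ?subrr.
(* In the moment identity for [r = 0] only the leading term [m = n] survives. *)
have diff_n : \sum_(i < n) x i ^+ n - \sum_(i < n) y i ^+ n = - (c * n%:R).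
  have := psum_moment_diff 0.
  rewrite big_ord_recr /= coefn_roots_poly mul1r addn0 sumr_const card_ord.
  rewrite big1 ?add0r // => m _; have := ltn_ord m => lt_mn.
  by rewrite addn0 eq0 ?mulr0 //; lia.
have lt_pred : (n.-1 < n)%N by lia.
(* For [r = 1] two terms survive: [m = n] gives the wanted difference, and [m = n.-1] gives
   $(-p_1)(-cn)$. The right side is $-c p_1$, whence the factor $n + 1$. *)
have := psum_moment_diff 1.
rewrite big_ord_recr /= coefn_roots_poly mul1r addn1 (bigD1 (Ordinal lt_pred)) //=.
rewrite addn1 (prednK (ltnW n_ge2)) diff_n coef_pred [\sum_(i < n | i != _) _]big1 ?addr0 => [|m].
  under [\sum_(i < n) y i ^+ 1]eq_bigr do rewrite expr1.
  rewrite -psum1 -natr1 => E.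
  rewrite -[LHS](addKr (- (\sum_(i < n) x i) * - (c * n%:R))) E; ring.
rewrite -val_eqE /= => /eqP neq_m; have := ltn_ord m => lt_mn.
by rewrite addn1 eq0 ?mulr0 //; lia.
Qed.

(** If $c = 0$, the two polynomials coincide, so a root $x_i$ of the first is some $y_j$. *)
Lemma roots_poly_coef0_neq : (0 < n)%N -> (forall i j, x i <> y j) -> c != 0.
Proof.
move=> n_gt0 neq_xy; apply/eqP => c0; pose i := Ordinal n_gt0.
have := roots_poly_root x i; rewrite roots_poly_eqDC c0 addr0 horner_prod.
move/eqP/prodf_eq0 => [j _]; rewrite hornerXsubC subr_eq0 => /eqP.
exact: neq_xy.
Qed.

End EqualPowerSums.

Theorem theorem6p1 (n : nat) (hn : (2 <= n)%N) (x y : 'I_n -> rat)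
    (hxy : pte_ideal x y) :
  \sum_(i < n) x i = 0 <->
  \sum_(i < n) x i ^+ n.+1 = \sum_(i < n) y i ^+ n.+1.
Proof.
have [neq_xy eq_psum] := hxy.
have c_neq0 := roots_poly_coef0_neq eq_psum (ltnW hn) neq_xy.
have diff := psum_diff_succ eq_psum hn.
split=> [x0|/eqP]; first by apply/eqP; rewrite -subr_eq0 diff x0 mulr0 oppr0.
rewrite -subr_eq0 diff oppr_eq0 !mulf_eq0 pnatr_eq0 (negPf c_neq0) /=.
exact: eqP.
Qed.
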